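(* There are infinitely many pairwise non-isomorphic finite simple graphs that are $6$-valent, connected and vertex-transitive and have no Hamilton decomposition.
   Context: A graph is $k$-valent if every vertex has degree $k$. A Hamilton decomposition of a $k$-valent graph $X$ is a set of $\lfloor k/2\rfloor$ pairwise edge-disjoint Hamilton cycles in $X$. *)

(* Defs.v *)
From mathcomp Require Import all_boot all_fingroup.

Set Implicit Arguments.
Unset Strict Implicit.
Unset Printing Implicit Defensive.

Record sgraph := SGraph {
  vertex :> finType;
  edge : rel vertex;
  edge_sym : symmetric edge;
  edge_irrefl : irreflexive edge
}.

Definition isomorphic (X Y : sgraph) : Prop :=
  exists2 f : X -> Y,
    bijective f & forall x y : X, edge (f x) (f y) = edge x y.

Definition valent (k : nat) (X : sgraph) : Prop :=
  forall x : X, #|[set y : X | edge x y]| = k.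

Definition connected (X : sgraph) : Prop :=
  0 < #|X| /\ forall x y : X, connect (@edge X) x y.

Definition automorphism (X : sgraph) (s : {perm X}) : Prop :=
  forall x y : X, edge (s x) (s y) = edge x y.

Definition vertex_transitive (X : sgraph) : Prop :=
  forall x y : X, exists2 s : {perm X}, automorphism s & s x = y.

(* A Hamilton cycle is identified with its edge set, an edge being a pair
   [set x; y], so that rotating or reversing the cyclic sequence s of
   vertices gives the same cycle. The bound on the size of s excludes going
   back and forth along an edge, which ucycle accepts as a cycle. *)
Definition hamilton_cycle (X : sgraph) (C : {set {set X}}) : Prop :=
  exists s : seq X,
    [/\ ucycle (@edge X) s, 2 < size s, forall x : X, x \in s
      & C = [set [set x; next s x] | x : X]].

(* Meaningful for a k-valent graph X. *)
Definition hamilton_decomposition (k : nat) (X : sgraph)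
    (D : {set {set {set X}}}) : Prop :=
  [/\ #|D| = k %/ 2,
      forall C, C \in D -> hamilton_cycle C
    & forall C C', C \in D -> C' \in D -> C != C' -> [disjoint C & C']].

(* Main.v *)
Require Import Defs.
From mathcomp Require Import all_boot all_fingroup all_algebra zify ring.

Set Implicit Arguments.
Unset Strict Implicit.
Unset Printing Implicit Defensive.

(** The graphs are obtained from a bipartite cubic graph H, whose white
and black vertices are both indexed by W: double every edge of H, then replace
each vertex by a complete graph K_6, one vertex for each of the six edge ends
meeting there.
Every vertex then has five neighbours in its block K_6 and one neighbour
outside, so the result is 6-valent.

Suppose that it has three edge-disjoint Hamilton cycles. Six edges leave each
block and each cycle uses at least two of them, so each cycle uses exactly two
and every edge between blocks is used exactly once ([used_in_exact]). A cycle
cannot use both copies of an edge of H, because it would be trapped in the two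
blocks that they join ([uses_twin]). Hence each cycle runs through two of the
three edges of H at every vertex and misses the third; every edge of H is used
by two of the three cycles and missed by the remaining one. Colouring each edge
of H by the cycle that misses it therefore gives a proper 3-edge-colouring in
which any two colours together form a Hamilton cycle of H: a perfect
1-factorization.

A parity argument due to Kotzig now forces #|W| to be odd. Colour k is a
bijection s_k from white to black vertices, and for i <> j the permutation
that follows colour j from white to black and colour i back to white is a
single cycle of length #|W| ([odd_missed_perms]). If #|W| is even such a cycle
is odd, so s_0, s_1, s_2 have pairwise distinct signatures, which is absurd.

For H take the hexagonal lattice on the torus Z_b x Z_b with b even, where
#|W| = b ^ 2. The translations, a half turn exchanging the two colour classes,
a third of a turn about a white vertex and the exchange of the two copies of
all edges make the inflated graph vertex-transitive; distinct b give graphs of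
distinct orders 12 * b ^ 2. *)

(** * Hamilton cycles as permutations *)

(** The successor map of a Hamilton cycle. That it is a single cycle is recorded
by the absence of proper nonempty closed sets, which is what cut arguments
need. *)
Lemma hamilton_cycle_perm (X : sgraph) (C : {set {set X}}) :
  hamilton_cycle C ->
  exists f : {perm X},
    [/\ forall x, edge x (f x), forall x, f (f x) != x,
        forall (S : {set X}) x, x \in S ->
          (forall y, y \in S -> f y \in S) -> S = setT
      & C = [set [set x; f x] | x : X]].
Proof.
case=> s [/andP[cyc_s uniq_s] size_s all_s ->].
have inj_f : injective (next s) := can_inj (prev_next uniq_s).
exists (perm inj_f).
have closed_full (S : {set X}) x : x \in S ->
    (forall y, y \in S -> perm inj_f y \in S) -> S = setT.
  move=> Sx closedS; apply/setP=> y; rewrite inE.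
  have : fconnect (next s) x y.
    by rewrite (fconnect_cycle (cycle_next uniq_s)).
  move/iter_findex=> <-; elim: (findex _ _ _) => //= n IHn.
  by have := closedS _ IHn; rewrite permE.
split=> //.
- by move=> x; rewrite permE; apply: next_cycle.
- move=> x; apply: contraTneq size_s => ffx; rewrite -leqNgt.
  have S_full : [set x; perm inj_f x] = setT.
    apply: (closed_full _ x) => [|y]; rewrite ?set21 // => /set2P[]->.
      exact: set22.
    by rewrite ffx set21.
  apply: (@uniq_leq_size _ s [:: x; perm inj_f x]) => // y _.
  by have := in_setT y; rewrite -S_full !inE.
- by apply: eq_imset => x; rewrite permE.
Qed.

(** * Doubling edges and inflating vertices of a bipartite cubic graph *)

Section Truncation.

Variables (W : finType) (p : 'I_3 -> {perm W}).

(** An end of a doubled edge of the cubic graph H in which the white vertex w is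
joined to the black vertices p c w. The dart (w, c, e, s) is the end of copy e
of the edge from w to p c w, the white end if s is false and the black end
otherwise. Both ends carry the name w of the white endpoint, so that [cross]
only flips a boolean. *)
Definition dart : finType := (W * 'I_3 * bool * bool)%type.

Definition cross (x : dart) : dart := let: (w, c, e, s) := x in (w, c, e, ~~ s).
Definition twin (x : dart) : dart := let: (w, c, e, s) := x in (w, c, ~~ e, s).
(** The vertex of H at which a dart sits, with its colour (true for black). *)
Definition block (x : dart) : W * bool :=
  let: (w, c, e, s) := x in (if s then p c w else w, s).

Definition adj (x y : dart) : bool :=
  (x != y) && ((block x == block y) || (y == cross x)).

Lemma crossK : involutive cross.
Proof. by case=> [[[w c] e] s] /=; rewrite negbK. Qed.

Lemma twinK : involutive twin.
Proof. by case=> [[[w c] e] s] /=; rewrite negbK. Qed.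

Lemma twin_cross x : twin (cross x) = cross (twin x).
Proof. by case: x => [[[w c] e] s]. Qed.

Lemma block_twin x : block (twin x) = block x.
Proof. by case: x => [[[w c] e] s]. Qed.

Lemma twin_neq x : twin x != x.
Proof. by case: x => [[[w c] [] ] s]; rewrite !xpair_eqE andbF. Qed.

Lemma block_cross_neq x : block (cross x) != block x.
Proof. by case: x => [[[w c] e] []]; rewrite xpair_eqE andbF. Qed.

Lemma adj_sym : symmetric adj.
Proof.
move=> x y; rewrite /adj eq_sym [block x == _]eq_sym; congr (_ && (_ || _)).
by rewrite -(inj_eq (can_inj crossK)) crossK eq_sym.
Qed.

Lemma adj_irrefl : irreflexive adj.
Proof. by move=> x; rewrite /adj eqxx. Qed.

Definition trunc : sgraph := SGraph adj_sym adj_irrefl.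

Lemma card_block b : #|[set x | block x == b]| = 6.
Proof.
case: b => w s.
pose g (ce : 'I_3 * bool) : dart :=
  (if s then (p ce.1)^-1%g w else w, ce.1, ce.2, s).
have inj_g : injective g by move=> [c e] [c' e'] [_ -> ->].
have -> : [set x | block x == (w, s)] = [set g ce | ce : 'I_3 * bool].
  apply/setP=> -[[[w' c] e] s']; rewrite inE.
  apply/eqP/imsetP=> [[hw hs]|[[c' e'] _ [-> -> -> ->]]].
    by exists (c, e); rewrite // /g -hw -hs; case: (s'); rewrite ?permK.
  by rewrite /=; case: (s); rewrite ?permKV.
by rewrite card_imset // card_prod card_ord card_bool.
Qed.

Lemma trunc_valent : valent 6 trunc.
Proof.
move=> x; pose B := [set y | block y == block x].
have -> : [set y : trunc | edge x y] = cross x |: (B :\ x).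
  apply/setP=> y; rewrite !inE /= /adj [y == x]eq_sym [block y == _]eq_sym.
  case: eqP => [<-|_] /=; last by rewrite orbC.
  apply/esym/negbTE; rewrite orbF.
  by apply: contraNneq (block_cross_neq x) => <-.
rewrite cardsU1 !inE (negbTE (block_cross_neq x)) andbF /=.
by have := cardsD1 x B; rewrite card_block inE eqxx => <-.
Qed.

(** * Three disjoint Hamilton cycles give a perfect 1-factorization *)

Section HamiltonDecomposition.

Variable f : 'I_3 -> {perm dart}.
Hypothesis f_adj : forall k x, adj x (f k x).
Hypothesis f_nback : forall k x, f k (f k x) != x.
Hypothesis f_full : forall k (S : {set dart}) x, x \in S ->
  (forall y, y \in S -> f k y \in S) -> S = setT.
Hypothesis f_disj : forall k l x y, k != l -> [set x; f k x] != [set y; f l y].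
Hypothesis W_even : ~~ odd #|W|.
Hypothesis W_gt0 : 0 < #|W|.

(** Cycle k contains the edge between blocks at x, in either direction. *)
Definition uses k x := (f k x == cross x) || (f k (cross x) == x).

Lemma uses_cross k x : uses k (cross x) = uses k x.
Proof. by rewrite /uses crossK orbC. Qed.

Lemma uses_inj k l x : uses k x -> uses l x -> k = l.
Proof.
have usesE m : uses m x -> exists y, [set x; cross x] = [set y; f m y].
  case/orP=> /eqP fx; first by exists x; rewrite fx.
  by exists (cross x); rewrite fx setUC.
move=> /usesE[y xy] /usesE[z xz]; apply: contra_eq (etrans (esym xy) xz).
exact: f_disj.
Qed.

Lemma leave_block k x : block (f k x) != block x -> f k x = cross x.
Proof.
have /andP[_ /orP[/eqP->|/eqP//]] := f_adj k x.
by rewrite eqxx.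
Qed.

(** A cycle can only leave a union of blocks through one of the edges between
blocks that it uses, so a union of blocks closed under these edges is
everything. *)
Lemma full_of_cross_closed k (b : pred (W * bool)) x : b (block x) ->
    (forall y, uses k y -> b (block y) -> b (block (cross y))) ->
  forall y, b (block y).
Proof.
move=> bx closed_b y.
suff /setP/(_ y) : [set z | b (block z)] = setT by rewrite !inE.
apply: (@f_full k _ x) => [|z]; rewrite ?inE // => bz.
have [-> //|/leave_block fz] := eqVneq (block (f k z)) (block z).
by rewrite fz closed_b // /uses fz eqxx.
Qed.

Lemma exists_block (b : W * bool) : exists x, block x = b.
Proof.
have /card_gt0P[x] : 0 < #|[set x | block x == b]| by rewrite card_block.
by rewrite inE => /eqP; exists x.
Qed.

Lemma three_blocks (a b : W * bool) : exists2 c, c != a & c != b.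
Proof.
have [c /andP[]|no_c] := pickP (fun c => (c != a) && (c != b)).
  by exists c.
have : #|[set: W * bool]| <= #|[set a; b]|.
  apply/subset_leq_card/subsetP => c _; have := no_c c.
  by rewrite !inE -negb_or; case: orP.
rewrite cardsT card_prod card_bool cards2.
by move: W_even W_gt0; case: #|W| => [|[|n]] //; case: (a != b).
Qed.

Definition used_in k b := [set x | (block x == b) && uses k x].

(** A Hamilton cycle must leave the block b and come back, and it cannot come
back along the edge by which it left. *)
Lemma used_in_ge2 k b : 2 <= #|used_in k b|.
Proof.
have [x0 bx0] := exists_block b; have [c cb _] := three_blocks b b.
have [x1 cx1] := exists_block c.
(* x is where the cycle leaves b; cross y is where it enters b. *)
have [x xb fxb] : exists2 x, block x = b & block (f k x) != b.
  case: (pickP (fun x => (block x == b) && (block (f k x) != b))) => [x|no_x].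
    by case/andP=> /eqP; exists x.
  have /setP/(_ x1) : [set x | block x == b] = setT.
    apply: (@f_full k _ x0) => [|y]; rewrite !inE ?bx0 // => by_.
    by have := no_x y; rewrite by_ /= => /negbFE.
  by rewrite !inE cx1 (negbTE cb).
have [y yb fyb] : exists2 y, block y != b & block (f k y) = b.
  case: (pickP (fun y => (block y != b) && (block (f k y) == b))) => [y|no_y].
    by case/andP=> yb /eqP; exists y.
  have /setP/(_ x0) : [set x | block x != b] = setT.
    apply: (@f_full k _ x1) => [|y]; rewrite !inE ?cx1 // => by_.
    by have := no_y y; rewrite by_ /= => /negbT.
  by rewrite !inE bx0 eqxx.
have fx : f k x = cross x by apply: leave_block; rewrite xb.
have fy : f k y = cross y by apply: leave_block; rewrite fyb eq_sym.
have neq_xy : x != cross y.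
  apply: contraNneq (f_nback k y) => xy.
  by rewrite fy -xy fx xy crossK.
rewrite -(_ : #|[set x; cross y]| = 2); last by rewrite cards2 neq_xy.
apply/subset_leq_card/subsetP=> z /set2P[]->.
  by rewrite inE xb eqxx /uses fx eqxx.
by rewrite inE -fy fyb eqxx {1}fy uses_cross /uses fy eqxx.
Qed.

(** Double counting the pairs (k, x) with x in b and [uses k x]: there are at
least 3 * 2 of them because each cycle crosses the boundary of b twice, and at
most 6 because the six edges leaving b are each used at most once. Equality
must hold in every term. *)
Lemma used_in_exact b :
  (forall k, #|used_in k b| = 2) /\
  (forall x, block x = b -> exists k, uses k x).
Proof.
have used_le1 x :
    \sum_k (uses k x : nat) <= 1 ?= iff (\sum_k (uses k x : nat) == 1).
  apply: leqif_eq; case: (pickP (uses^~ x)) => [k kx|no_k]; last first.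
    by rewrite big1 // => k _; rewrite no_k.
  rewrite (bigD1 k) //= kx big1 // => l lk; case lx: (uses l x) => //.
  by rewrite (uses_inj lx kx) eqxx in lk.
have upper := leqif_sum (fun x (_ : block x == b) => used_le1 x).
have lower := leqif_sum (fun k (_ : xpredT k) => leqif_eq (used_in_ge2 k b)).
have sumE : \sum_k #|used_in k b| =
    \sum_(x | block x == b) \sum_k (uses k x : nat).
  rewrite exchange_big; apply: eq_bigr => k _.
  rewrite -sum1_card big_mkcond [RHS]big_mkcond; apply: eq_bigr => x _.
  by rewrite inE; case: (block x == b); case: (uses k x).
rewrite sumE in lower; have [_] := leqif_trans lower upper.
have -> : \sum_(x | block x == b) 1 = 6.
  by rewrite -(card_block b) -sum1_card; apply: eq_bigl => x; rewrite inE.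
rewrite sum_nat_const card_ord eqxx => /esym/andP[/forallP all2 /forallP all1].
split=> [k|x /eqP xb]; first by have /eqP := all2 k.
case: (pickP (uses^~ x)) => [k kx|no_k]; first by exists k.
by have := all1 x; rewrite xb big1 // => k _; rewrite no_k.
Qed.

Lemma ex_uses x : exists k, uses k x.
Proof. by have [_ /(_ x)] := used_in_exact (block x); apply. Qed.

(** If cycle k used both copies of an edge of H, these would be its only edges
leaving either of the two blocks that they join, and it could not reach a third
block. *)
Lemma uses_twin k x : uses k x -> ~~ uses k (twin x).
Proof.
move=> kx; apply/negP=> ktx; set b := block x; set b' := block (cross x).
have used_pair y : uses k y ->
  uses k (twin y) -> used_in k (block y) = [set y; twin y].
  move=> ky kty; apply/esym/eqP; rewrite eqEcard (used_in_exact _).1.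
  rewrite cards2 eq_sym twin_neq andbT; apply/subsetP=> z /set2P[]->.
    by rewrite inE eqxx.
  by rewrite inE block_twin eqxx.
have [c /negP cb /negP cb'] := three_blocks b b'.
have [z zc] := exists_block c.
suff : (block z == b) || (block z == b') by rewrite zc => /orP[].
apply: (@full_of_cross_closed k (fun d => (d == b) || (d == b')) x).
  by rewrite eqxx.
move=> y ky /orP[]/eqP yb.
  have : y \in used_in k (block x) by rewrite inE -/b yb eqxx.
  rewrite used_pair // => /set2P[]->; first by rewrite eqxx orbT.
  by rewrite -twin_cross block_twin eqxx orbT.
have : y \in used_in k (block (cross x)) by rewrite inE -/b' yb eqxx.
rewrite used_pair ?twin_cross ?uses_cross // => /set2P[]->.
  by rewrite crossK eqxx.
by rewrite crossK block_twin eqxx.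
Qed.

(** Cycle k avoids both copies of the edge of H at x: this edge has colour k. *)
Definition missed k x := ~~ uses k x && ~~ uses k (twin x).

Lemma missed_cross k x : missed k (cross x) = missed k x.
Proof. by rewrite /missed twin_cross !uses_cross. Qed.

Lemma missed_twin k x : missed k (twin x) = missed k x.
Proof. by rewrite /missed twinK andbC. Qed.

(** Of the six darts of b, cycle k uses two, whose twins are two others by
[uses_twin]. The remaining two darts are the copies of the only edge of H at
this vertex that has colour k. *)
Lemma card_missed k b : #|[set x | (block x == b) && missed k x]| = 2.
Proof.
pose U := used_in k b; pose U' := [set x | (block x == b) && uses k (twin x)].
have cardU : #|U| = 2 := (used_in_exact b).1 k.
have cardU' : #|U'| = 2.
  rewrite -cardU -[in RHS](card_imset _ (can_inj twinK)); apply: eq_card => x.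
  rewrite -[x in RHS]twinK (mem_imset _ _ (can_inj twinK)) !inE.
  by rewrite block_twin.
have disjUU' : U :&: U' = set0.
  apply/setP=> x; rewrite !inE; apply/negP.
  by case/andP=> /andP[_ /uses_twin/negbTE->]; rewrite andbF.
have := cardsUI U U'; rewrite disjUU' cards0 addn0 cardU cardU' => cardUU'.
have := cardsID (U :|: U') [set x | block x == b].
rewrite card_block (_ : _ :&: _ = U :|: U'); last first.
  by apply/setP=> x; rewrite !inE; case: (block x == b).
rewrite cardUU' => -[] <-; apply: eq_card => x; rewrite !inE /missed.
by case: (block x == b); rewrite ?andbF // ?negb_or andbT.
Qed.

Lemma ex_missed k b : exists2 x, block x = b & missed k x.
Proof.
have : 0 < #|[set x | (block x == b) && missed k x]| by rewrite card_missed.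
by case/card_gt0P=> x; rewrite inE => /andP[/eqP]; exists x.
Qed.

Lemma missed_inj k x y : block x = block y -> missed k x -> missed k y ->
  x = y \/ x = twin y.
Proof.
move=> bxy kx ky.
have eqM : [set y; twin y] = [set z | (block z == block y) && missed k z].
  apply/eqP; rewrite eqEcard card_missed cards2 eq_sym twin_neq andbT.
  by apply/subsetP=> z /set2P[]->; rewrite inE ?block_twin ?missed_twin eqxx.
by apply/set2P; rewrite eqM inE bxy eqxx.
Qed.

(** The two copies of an edge of H are used by two distinct cycles, so the third
cycle misses it; if one of the two is k, then the third is i or j. *)
Lemma missed_or (i j k : 'I_3) x : i != j -> i != k -> j != k ->
  uses k x -> missed i x || missed j x.
Proof.
move=> ij ik jk kx; have [l lx] := ex_uses (twin x).
have not_use m y n : uses n y -> m != n -> ~~ uses m y.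
  by move=> ny; apply: contra => my; apply/eqP/(uses_inj my ny).
rewrite /missed !(not_use _ _ _ kx) //=.
have [il|il] := eqVneq i l; last by rewrite (not_use _ _ _ lx).
by rewrite (not_use j _ _ lx) ?orbT // -il eq_sym.
Qed.

(** Each colour class is a perfect matching of H, that is, a bijection from
white to black vertices. *)
Lemma missed_perm k :
  exists s : {perm W}, forall w c e b, missed k (w, c, e, b) -> p c w = s w.
Proof.
have ex_c w : exists c, missed k (w, c, false, false).
  have [[[[w' c] e] [] ] [] // eq_w kx] := ex_missed k (w, false).
  exists c; move: kx; rewrite eq_w => kx.
  by case: e kx => // kx; rewrite -missed_twin.
have normal w c e b : missed k (w, c, e, b) -> missed k (w, c, false, b).
  by case: e => // kx; rewrite -missed_twin.
have [c kc] := fin_all_exists ex_c.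
have inj_s : injective (fun w => p (c w) w).
  move=> w w' eq_ww'.
  have := kc w; have := kc w'.
  rewrite -(missed_cross _ (w', _, _, _)) -(missed_cross _ (w, _, _, _)).
  move=> kw' kw; have same_block :
      block (cross (w, c w, false, false)) =
      block (cross (w', c w', false, false)).
    by rewrite /= eq_ww'.
  by case: (missed_inj same_block kw kw') => -[].
exists (perm inj_s) => w c' e b /normal kx; rewrite permE.
have {}kx : missed k (w, c', false, false).
  by case: b kx => // kx; rewrite -missed_cross.
by case: (missed_inj _ kx (kc w)) => [//|[]->|[]].
Qed.

(** With k the third index, cycle k only runs through edges of colours i and j.
If S is an orbit of s^-1 o t on white vertices, then the white blocks of S and
the black blocks of s(S) = t(S) form a set that cycle k cannot leave, so S
contains all white vertices. Thus s^-1 o t is a cycle of even length #|W|, an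
odd permutation. *)
Lemma odd_missed_perms (i j : 'I_3) (s t : {perm W}) : i != j ->
    (forall w c e b, missed i (w, c, e, b) -> p c w = s w) ->
    (forall w c e b, missed j (w, c, e, b) -> p c w = t w) ->
  odd_perm s != odd_perm t.
Proof.
move=> ij sP tP; have [k ik jk] : exists2 k, i != k & j != k.
  case: (pickP (fun k => (i != k) && (j != k))) => [k /andP[]|no_k].
    by exists k.
  have : #|'I_3| <= #|[set i; j]|.
    apply/subset_leq_card/subsetP=> k _; have := no_k k.
    by rewrite !inE ![k == _]eq_sym -negb_or; case: orP.
  by rewrite card_ord cards2; case: (i != j).
(* Permutations multiply from left to right: q is s^-1 o t. *)
pose q := (t * s^-1)%g.
have qE w : q w = (s^-1)%g (t w) by rewrite permM.
have [w0 _] : exists w : W, true by have /card_gt0P[w] := W_gt0; exists w.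
have orbit_full : porbit q w0 = setT.
  pose inS (d : W * bool) :=
    (if d.2 then (s^-1)%g d.1 else d.1) \in porbit q w0.
  have stepS w : (q w \in porbit q w0) = (w \in porbit q w0).
    rewrite [LHS]porbit_sym [RHS]porbit_sym.
    by have := porbit_perm q 1 w; rewrite expg1 => ->.
  have inS_all : forall y, inS (block y).
    have [x xw0] := exists_block (w0, false).
    apply: (@full_of_cross_closed k inS x); first by rewrite xw0 /inS porbit_id.
    move=> [[[w c] e] b] kx.
    suff : p c w = s w \/ p c w = t w.
      by rewrite /inS; case: b {kx} => /= -[]->; rewrite ?permK // -qE stepS.
    by case/orP: (missed_or ij ik jk kx) => [/sP|/tP]; [left|right].
  apply/setP=> w; rewrite inE; have [y yw] := exists_block (w, false).
  by have := inS_all y; rewrite yw.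
have : odd_perm q.
  rewrite /odd_perm (_ : porbits q = [set setT]) ?cards1.
    by rewrite (negbTE W_even).
  apply/setP=> P; rewrite inE; apply/imsetP/eqP=> [[w _ ->]|->].
    by rewrite -orbit_full; apply/eqP; rewrite eq_porbit_mem orbit_full inE.
  by exists w0.
by rewrite odd_permM odd_permV; do 2!case: odd_perm.
Qed.

(** Three signs cannot be pairwise distinct. *)
Lemma no_three_disjoint_hamilton_perms : False.
Proof.
have [s sP] := fin_all_exists missed_perm.
have odd_s i j : i != j -> odd_perm (s i) != odd_perm (s j).
  by move=> ij; apply: odd_missed_perms ij (sP i) (sP j).
have := odd_s (@Ordinal 3 0 isT) (@Ordinal 3 1 isT) isT.
have := odd_s (@Ordinal 3 0 isT) (@Ordinal 3 2 isT) isT.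
have := odd_s (@Ordinal 3 1 isT) (@Ordinal 3 2 isT) isT.
by do 3!case: odd_perm.
Qed.

End HamiltonDecomposition.

Lemma trunc_no_hamilton_decomposition D :
  ~~ odd #|W| -> 0 < #|W| -> ~ @hamilton_decomposition 6 trunc D.
Proof.
move=> W_even W_gt0 [cardD hamD disjD].
have cardD3 : 3 = #|D| by rewrite cardD.
pose C (k : 'I_3) := enum_val (cast_ord cardD3 k).
have C_in k : C k \in D by apply: enum_valP.
have [f fP] := fin_all_exists (fun k => hamilton_cycle_perm (hamD _ (C_in k))).
apply: (@no_three_disjoint_hamilton_perms f) => //.
- by move=> k; case: (fP k).
- by move=> k; case: (fP k).
- by move=> k; case: (fP k).
move=> k l x y kl.
have Cl : C k != C l by apply: contraNneq kl => /enum_val_inj/cast_ord_inj->.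
have := disjD _ _ (C_in k) (C_in l) Cl.
have [_ _ _ ->] := fP k; have [_ _ _ ->] := fP l.
move=> /disjointFr disj; apply/eqP=> eq_xy.
have : [set x; f k x] \in [set [set z; f k z] | z : trunc].
  by apply/imsetP; exists x.
by move/disj/negP; apply; apply/imsetP; exists y.
Qed.

End Truncation.
(** * Automorphisms *)

Section Automorphisms.

Variables (W : finType) (p : 'I_3 -> {perm W}).

(** An automorphism is obtained from an injection of darts that respects edges
between blocks and induces an injection g of blocks; g serves to reflect the
equality of blocks. *)
Lemma trunc_automorphism (h : dart W -> dart W) (g : W * bool -> W * bool) :
    injective h -> injective g -> (forall x, cross (h x) = h (cross x)) ->
    (forall x, block p (h x) = g (block p x)) ->
  exists2 s : {perm trunc p}, automorphism s & s =1 h.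
Proof.
move=> inj_h inj_g h_cross h_block; exists (perm inj_h) => [x y|x].
  rewrite /= /adj !permE (inj_eq inj_h) !h_block (inj_eq inj_g) h_cross.
  by rewrite (inj_eq inj_h).
by rewrite permE.
Qed.

End Automorphisms.

Section Similar.

Variable X : sgraph.

Definition similar (x y : X) := exists2 s : {perm X}, automorphism s & s x = y.

Lemma similar_sym x y : similar x y -> similar y x.
Proof.
case=> s s_aut <-; exists (s^-1)%g; last by rewrite permK.
by move=> u v; rewrite -s_aut !permKV.
Qed.

Lemma similar_trans y x z : similar x y -> similar y z -> similar x z.
Proof.
case=> s s_aut <- [t t_aut <-]; exists (s * t)%g; last by rewrite permM.
by move=> u v; rewrite !permM t_aut s_aut.
Qed.

End Similar.

(** * The hexagonal lattice on a torus *)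

Section HexagonalTorus.

Import GRing.Theory.
Local Open Scope ring_scope.

Variable m : nat.
Notation R := 'I_m.+2.
Notation W := (R * R)%type.

(** The white vertex (x, y) stands for (x, y, - x - y) and the black vertex
(x, y) for (x, y, 1 - x - y), the triples of sum 0 and 1; edges add one of the
three unit vectors. This makes the cyclic symmetry of order 3 visible. *)
Definition hex_dir (c : 'I_3) : W := ((c == 0)%:R, (c == 1)%:R).
Definition hex_perm (c : 'I_3) : {perm W} := perm (@addIr W (hex_dir c)).

Lemma hex_permE c w : hex_perm c w = w + hex_dir c.
Proof. by rewrite permE. Qed.

Definition hex_trunc := trunc hex_perm.

Lemma card_hex_trunc : #|hex_trunc| = (12 * (m.+2 * m.+2))%N.
Proof. by rewrite /= !card_prod !card_ord card_bool; ring. Qed.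

Definition translate a (x : dart W) : dart W :=
  let: (w, c, e, s) := x in (w + a, c, e, s).
(** Negation exchanges the colours and maps the edge from w to w + hex_dir c to
the edge from - (w + hex_dir c) to - w, which has the same direction. *)
Definition half_turn (x : dart W) : dart W :=
  let: (w, c, e, s) := x in (- (w + hex_dir c), c, e, ~~ s).
(** The cyclic shift (x, y, z) -> (z, x, y) of coordinates. *)
Definition third_turn (x : dart W) : dart W :=
  let: (w, c, e, s) := x in ((- w.1 - w.2, w.1), c + 1, e, s).

Lemma similar_twin (x : hex_trunc) : similar x (twin x).
Proof.
have [s s_aut sE] := @trunc_automorphism _ hex_perm _ id (can_inj (@twinK W))
  (fun _ _ => id) (fun x => esym (twin_cross x)) (block_twin hex_perm).
by exists s; rewrite ?sE.
Qed.

Lemma similar_translate a (x : hex_trunc) : similar x (translate a x).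
Proof.
have [| | | |s s_aut sE] := @trunc_automorphism _ hex_perm (translate a)
  (fun b => (b.1 + a, b.2)); last by exists s; rewrite ?sE.
- by apply: (can_inj (g := translate (- a))) => -[[[w c] e] s] /=; rewrite addrK.
- by apply: (can_inj (g := fun b => (b.1 - a, b.2))) => -[w s] /=; rewrite addrK.
- by case=> [[[w c] e] s].
- by case=> [[[w c] e] []] //=; rewrite !hex_permE addrAC.
Qed.

Lemma similar_half_turn (x : hex_trunc) : similar x (half_turn x).
Proof.
have [| | | |s s_aut sE] := @trunc_automorphism _ hex_perm half_turn
  (fun b => (- b.1, ~~ b.2)); last by exists s; rewrite ?sE.
- apply: (can_inj (g := half_turn)) => -[[[w c] e] s] /=.
  by rewrite opprD opprK addrK negbK.
- apply: (can_inj (g := fun b : W * bool => (- b.1, ~~ b.2))) => -[w s] /=.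
  by rewrite opprK negbK.
- by case=> [[[w c] e] s].
- by case=> [[[w c] e] []] //=; rewrite !hex_permE // opprD addrNK.
Qed.

Lemma similar_third_turn (x : hex_trunc) : similar x (third_turn x).
Proof.
have [| | | |s s_aut sE] := @trunc_automorphism _ hex_perm third_turn
  (fun b => (((b.2 : nat)%:R - b.1.1 - b.1.2, b.1.1), b.2));
  last by exists s; rewrite ?sE.
- pose g (x : dart W) : dart W :=
    let: (w, c, e, s) := x in ((w.2, - w.1 - w.2), c - 1, e, s).
  apply: (can_inj (g := g)) => -[[[[u v] c] e] s]; rewrite /g /= addrK.
  by congr (_, _, _, _, _); ring.
- pose g (b : W * bool) := ((b.1.2, (b.2 : nat)%:R - b.1.1 - b.1.2), b.2).
  apply: (can_inj (g := g)) => -[[u v] s]; rewrite /g /=.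
  by congr (_, _, _); ring.
- by case=> [[[w c] e] s].
(* The third coordinate of the black vertex w + hex_dir c is
   1 - w.1 - w.2 - [c = 0] - [c = 1] = - w.1 - w.2 + [c = 2]. *)
- case=> [[[[x1 x2] c] e] []] /=; rewrite ?hex_permE ?sub0r //.
  congr (_, _).
  by case: c => [[|[|[]]]] //= ?; congr (_, _); rewrite /=; ring.
Qed.

Lemma hex_trunc_vertex_transitive : vertex_transitive hex_trunc.
Proof.
pose x0 : hex_trunc := (0, 0, false, false).
suff to_x0 x : similar x x0.
  by move=> x y; apply: similar_trans (to_x0 x) (similar_sym (to_x0 y)).
wlog s_white : x / x.2 = false.
  move: x => [[[w c] e] [] ] whites; last exact: whites.
  apply: similar_trans (similar_half_turn _) _; exact: whites.
wlog e_false : x s_white / x.1.2 = false.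
  move: x s_white => [[[w c] []] s] /= s_white copies; last exact: copies.
  apply: similar_trans (similar_twin _) _; exact: copies.
wlog c_zero : x s_white e_false / x.1.1.2 = 0.
  have turn (y : hex_trunc) :
      similar (third_turn y : hex_trunc) x0 -> similar y x0.
    exact: similar_trans (similar_third_turn _).
  move: x s_white e_false => [[[w c] e] s] /= -> -> dirs.
  (* n is the number of third turns that bring direction c to 0. *)
  case: (pickP (fun n : 'I_3 => c + n == 0)) => [n|/(_ (- c))]; last first.
    by rewrite subrr eqxx.
  case: n => [[|[|[]]]] //= lt_n3 /eqP cn.
  - by apply: dirs => //=; rewrite -cn; apply/val_inj; rewrite /= addn0 modn_small.
  - by apply: turn; apply: dirs => //=; rewrite -cn; congr (_ + _); apply/val_inj.
  - apply/turn/turn; apply: dirs => //=; rewrite -cn -addrA; congr (_ + _).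
    exact/val_inj.
move: x s_white e_false c_zero => [[[w c] e] s] /= -> -> ->.
have := similar_translate (- w) (w, 0, false, false).
by rewrite /translate subrr.
Qed.

(** Two edges of H lead from the white vertex w to
w + hex_dir c - hex_dir c', and these differences generate the torus. *)
Lemma hex_trunc_connected : connected hex_trunc.
Proof.
pose E := @edge hex_trunc.
have sym_E : connect_sym E by apply: sym_connect_sym; apply: edge_sym.
split; first by rewrite card_hex_trunc.
have same_block x y : block hex_perm x = block hex_perm y -> connect E x y.
  have [-> //|xy] := eqVneq x y.
  by move=> eq_b; apply: connect1; rewrite /E /= /adj xy eq_b eqxx.
have crossing x : connect E x (cross x).
  apply: connect1; rewrite /E /= /adj eqxx orbT andbT.
  by apply: contraNneq (block_cross_neq hex_perm x) => <-.
pose white w : hex_trunc := (w, 0, false, false).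
have to_white w c e s : connect E (w, c, e, s) (white w).
  apply: (@connect_trans _ _ (w, c, e, false)); last exact: same_block.
  by case: s => //; apply: crossing.
have step w c c' : connect E (white w) (white (w + hex_dir c - hex_dir c')).
  apply: (@connect_trans _ _ (w, c, false, false)); first exact: same_block.
  apply: connect_trans (crossing _) _; rewrite /=.
  apply: connect_trans (to_white _ c' false true).
  by apply: same_block; rewrite /= !hex_permE subrK.
have from0 w : connect E (white 0) (white w).
  have -> : w = (w.1%:R, w.2%:R) by rewrite !natr_Zp; case: w.
  elim: (nat_of_ord w.1) => [|a IHa]; last first.
    apply: connect_trans IHa _.
    have := step (a%:R, w.2%:R) 0 2; congr (connect E _ (white (_, _))).
      by rewrite /= -natr1; ring.
    by rewrite /=; ring.
  elim: (nat_of_ord w.2) => [|a IHa]; first exact: connect0.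
  apply: connect_trans IHa _.
  have := step (0, a%:R) 1 2; congr (connect E _ (white (_, _))).
    by rewrite /=; ring.
  by rewrite /= -natr1; ring.
have from_white0 x : connect E (white 0) x.
  by case: x => [[[w c] e] s]; apply: connect_trans (from0 w) _; rewrite sym_E.
by move=> x y; apply: connect_trans (from_white0 y); rewrite sym_E.
Qed.

End HexagonalTorus.

Theorem theorem9 :
  exists X : nat -> sgraph,
    (forall i j : nat, i <> j -> ~ isomorphic (X i) (X j)) /\
    (forall i : nat,
       [/\ valent 6 (X i), connected (X i), vertex_transitive (X i)
         & ~ exists D : {set {set {set X i}}}, hamilton_decomposition 6 D]).
Proof.
(* hex_trunc m lives on the torus Z_b x Z_b with b = m + 2. *)
exists (fun i => hex_trunc i.*2); split=> [i j ij [f bij_f _]|i].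
  apply: ij; have := bij_eq_card bij_f; rewrite !card_hex_trunc; nia.
split.
- exact: trunc_valent.
- exact: hex_trunc_connected.
- exact: hex_trunc_vertex_transitive.
- case=> D; apply: trunc_no_hamilton_decomposition; rewrite card_prod !card_ord //.
  by rewrite oddM /= odd_double.
Qed.
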